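(* Let $(N,w)$ be a cooperative interval game. Then $(N,w)$ is selection convex if and only if for every $S,T \in 2^N$ such that $S\not\subseteq T$, $T\not\subseteq S$, $S\neq\emptyset$, $T\neq\emptyset$ we have $$\overline{w}(S)+\overline{w}(T) \le \underline{w}(S\cup T)+\underline{w}(S\cap T).$$
   Context: Let $N=\{1,2,\ldots,n\}$ be a set of players, let $2^N$ be the power set of $N$, and let $\mathbb{IR}$ be the set of all closed real intervals $X=[\underline{X},\overline{X}]=\{x\in\mathbb{R}: \underline{X}\le x\le \overline{X}\}$. A (classical) cooperative game is a pair $(N,v)$ with $v:2^N\to\mathbb{R}$ and $v(\emptyset)=0$. A cooperative interval game is a pair $(N,w)$ with $w:2^N\to\mathbb{IR}$ and $w(\emptyset)=[0,0]$. Write $\underline{w}(S)$ and $\overline{w}(S)$ for the lower and upper bound of the interval $w(S)$. A selection of $(N,w)$ is a cooperative game $(N,v)$ with $v(S)\in w(S)$ for every $S\in 2^N$. A cooperative game $(N,v)$ is convex if $v$ is supermodular, i.e. $v(T)+v(S)\le v(S\cup T)+v(S\cap T)$ for every $S,T\subseteq N$. An interval game is selection convex if all its selections are convex games. *)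

(* Defs.v *)
From HB Require Import structures.
From mathcomp Require Import all_boot all_order all_algebra.
From mathcomp Require Import reals.

Set Implicit Arguments.
Unset Strict Implicit.
Unset Printing Implicit Defensive.

Import Order.TTheory GRing.Theory Num.Theory.
Local Open Scope ring_scope.

(* Closed real intervals are nonempty: every interval comes with
   [lower <= upper], so that it is determined by its two bounds. *)
Record closed_interval (R : realType) := ClosedInterval {
  lower : R;
  upper : R;
  lower_le_upper : lower <= upper
}.

Definition point_interval (R : realType) (x : R) : closed_interval R :=
  ClosedInterval (lexx x).

Definition in_interval (R : realType) (x : R) (X : closed_interval R) : Prop :=
  x \in `[lower X, upper X].

(* The player set {1, ..., n} is encoded as 'I_n. *)
Record coop_game (R : realType) (n : nat) := CoopGame {
  game_val :> {set 'I_n} -> R;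
  game_val0 : game_val set0 = 0
}.

Record interval_game (R : realType) (n : nat) := IntervalGame {
  igame_val :> {set 'I_n} -> closed_interval R;
  igame_val0 : igame_val set0 = point_interval 0
}.

Definition selection (R : realType) (n : nat)
    (w : interval_game R n) (v : coop_game R n) : Prop :=
  forall S : {set 'I_n}, in_interval (v S) (w S).

Definition convex_game (R : realType) (n : nat) (v : coop_game R n) : Prop :=
  forall S T : {set 'I_n}, v T + v S <= v (S :|: T) + v (S :&: T).

Definition selection_convex (R : realType) (n : nat)
    (w : interval_game R n) : Prop :=
  forall v : coop_game R n, selection w v -> convex_game v.

(* Main.v *)
(** If [S] and [T] are incomparable, then [S :|: T] and [S :&: T] both differ
    from [S] and [T], so the four values of a selection at these coalitions can
    be chosen independently: taking upper bounds at [S], [T] and lower bounds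
    elsewhere gives the selection that is hardest to make supermodular. For
    comparable [S] and [T] supermodularity is an equality. *)
Require Import Defs.
From mathcomp Require Import all_boot all_order all_algebra.
From mathcomp Require Import reals.

Import Order.TTheory GRing.Theory Num.Theory.
Local Open Scope ring_scope.

Section UpperOn.
Variables (R : realType) (n : nat) (w : interval_game R n).
Variables (P : pred {set 'I_n}).

Definition upper_on_val (X : {set 'I_n}) : R :=
  if P X then upper (w X) else lower (w X).

(** The interval at [set0] is degenerate, so both branches agree there and [P] can be arbitrary. *)
Lemma upper_on_val0 : upper_on_val set0 = 0.
Proof. by rewrite /upper_on_val igame_val0 /= if_same. Qed.

Definition upper_on : coop_game R n := CoopGame upper_on_val0.

Lemma upper_on_selection : selection w upper_on.
Proof.
move=> X; rewrite /in_interval in_itv /= /upper_on_val.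
by case: (P X); rewrite lexx lower_le_upper.
Qed.

End UpperOn.

Lemma convex_ineq_subset (R : realType) (n : nat) (v : coop_game R n)
    (S T : {set 'I_n}) :
  S \subset T -> v T + v S <= v (S :|: T) + v (S :&: T).
Proof. by move=> sST; rewrite (setUidPr sST) (setIidPl sST). Qed.

Theorem theorem4 (R : realType) (n : nat) (w : interval_game R n) :
  selection_convex w <->
  (forall S T : {set 'I_n},
     ~~ (S \subset T) -> ~~ (T \subset S) -> S != set0 -> T != set0 ->
     upper (w S) + upper (w T) <= lower (w (S :|: T)) + lower (w (S :&: T))).
Proof.
split=> [cvx S T nST nTS _ _ | H v sel S T].
  have := cvx _ (upper_on_selection R n w (pred2 S T)) S T.
  rewrite /= /upper_on_val /= !eqxx orbT /= addrC.
  (* Each of these four equalities would force an inclusion between [S] and [T]; hence the union and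
     the intersection fall in the lower branch. *)
  have /negPf -> : S :|: T != S by apply: contra nTS => /eqP/setUidPl.
  have /negPf -> : S :|: T != T by apply: contra nST => /eqP/setUidPr.
  have /negPf -> : S :&: T != S by apply: contra nST => /eqP/setIidPl.
  by have /negPf -> : S :&: T != T by apply: contra nTS => /eqP/setIidPr.
have [|nST] := boolP (S \subset T); first exact: convex_ineq_subset.
have [sTS|nTS] := boolP (T \subset S).
  by rewrite addrC setUC setIC; apply: convex_ineq_subset.
have S0 : S != set0 by apply: contraNneq nST => ->; apply: sub0set.
have T0 : T != set0 by apply: contraNneq nTS => ->; apply: sub0set.
have bounds X : (lower (w X) <= v X <= upper (w X)).
  by have := sel X; rewrite /in_interval in_itv.
have [/andP[_ vS] /andP[_ vT]] := (bounds S, bounds T).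
have [/andP[vU _] /andP[vI _]] := (bounds (S :|: T), bounds (S :&: T)).
(* The bound [H] separates the two sides: upper bounds dominate [v S + v T], lower bounds stay below
   the right-hand side. *)
rewrite addrC; apply: le_trans (lerD vS vT) _.
exact: le_trans (H S T nST nTS S0 T0) (lerD vU vI).
Qed.
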